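(* Let $N\ge 1$, let $\mathcal{X}\in\mathbb{R}^{I_1\times\cdots\times I_N}$ be a tensor with set of observable entries $\Omega$, let $\lambda>0$, and let $\mathcal{G}\in\mathbb{R}^{J_1\times\cdots\times J_N}$ and $\mathbf{A}^{(n)}\in\mathbb{R}^{I_n\times J_n}$ ($n=1,\dots,N$). Define $$L_1(\mathcal{G},\mathbf{A}^{(1)},\dots,\mathbf{A}^{(N)})=\sum_{\alpha\in\Omega}\Big(\mathcal{X}_\alpha-\sum_{\gamma}\mathcal{G}_\gamma\,p_{\alpha,\gamma}\Big)^2+\lambda\Big(\|\mathcal{G}\|_1+\sum_{n=1}^N\|\mathbf{A}^{(n)}\|_1\Big),$$ where, for $\alpha=(i_1,\dots,i_N)$ and a core-tensor index $\gamma=(j_1,\dots,j_N)$, $p_{\alpha,\gamma}=\prod_{n=1}^N a^{(n)}_{i_nj_n}$. Fix a core-tensor index $\beta$ and regard $L_1$ as a function of the single real variable $\mathcal{G}_\beta$, all other entries of $\mathcal{G}$ and all entries of the factor matrices being held fixed. Put $$g_c=-2\sum_{\alpha\in\Omega}\Big(\mathcal{X}_\alpha-\sum_{\gamma\ne\beta}\mathcal{G}_\gamma\,p_{\alpha,\gamma}\Big)p_{\alpha,\beta},\qquad d_c=2\sum_{\alpha\in\Omega}p_{\alpha,\beta}^2.$$ Then $$\operatorname*{arg\,min}_{\mathcal{G}_\beta}L_1(\mathcal{G},\mathbf{A}^{(1)},\dots,\mathbf{A}^{(N)})=\begin{cases}(\lambda-g_c)/d_c&\text{if }g_c>\lambda,\\-(\lambda+g_c)/d_c&\text{if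 }g_c<-\lambda,\\0&\text{otherwise.}\end{cases}$$
   Context: $\Omega\subseteq\{1,\dots,I_1\}\times\cdots\times\{1,\dots,I_N\}$ is the set of indices of observed entries of $\mathcal{X}$. $a^{(n)}_{ij}$ denotes the $(i,j)$ entry of $\mathbf{A}^{(n)}$. $\|\cdot\|_1$ is the sum of the absolute values of all entries (of a tensor or matrix). $\gamma$ ranges over all indices $(j_1,\dots,j_N)$ of $\mathcal{G}$. *)

(* Defs.v *)
(** A multi-index (i_1, ..., i_N) is a dependent finite function, and an
    order-N tensor is a finite function on multi-indices. Indices are
    0-based: {1, ..., I_n} is rendered as ['I_(I n)]. *)
From HB Require Import structures.
From mathcomp Require Import all_boot all_order all_algebra.
From mathcomp Require Import classical_sets reals.

Set Implicit Arguments.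
Unset Strict Implicit.
Unset Printing Implicit Defensive.

Import Order.TTheory GRing.Theory Num.Theory.
Local Open Scope ring_scope.

Definition mindex (N : nat) (I : 'I_N -> nat) : finType :=
  {dffun forall n : 'I_N, 'I_(I n)}.

Definition tensor (R : realType) (N : nat) (I : 'I_N -> nat) : Type :=
  {ffun mindex I -> R}.

Definition tensor_norm1 (R : realType) (N : nat) (I : 'I_N -> nat)
    (T : tensor R I) : R :=
  \sum_(a : mindex I) `|T a|.

Definition mx_norm1 (R : realType) (m n : nat) (B : 'M[R]_(m, n)) : R :=
  \sum_(i < m) \sum_(j < n) `|B i j|.

Definition tensor_set (R : realType) (N : nat) (I : 'I_N -> nat)
    (T : tensor R I) (b : mindex I) (x : R) : tensor R I :=
  [ffun a => if a == b then x else T a].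

(** The set of global minimizers of [f]. *)
Definition argmin (R : realType) (T : Type) (f : T -> R) : set T :=
  [set x | forall y, f x <= f y]%classic.

Section SparseTucker.
Variables (R : realType) (N : nat) (I J : 'I_N -> nat).
Variables (X : tensor R I) (Omega : {set mindex I}) (lambda : R).
Variables (G : tensor R J) (A : forall n : 'I_N, 'M[R]_(I n, J n)).

Definition factor_prod (alpha : mindex I) (gamma : mindex J) : R :=
  \prod_(n < N) A n (alpha n) (gamma n).

Definition L1_loss : R :=
  \sum_(alpha in Omega)
     (X alpha - \sum_(gamma : mindex J) G gamma * factor_prod alpha gamma) ^+ 2
  + lambda * (tensor_norm1 G + \sum_(n < N) mx_norm1 (A n)).

(** [g_core] does not depend on [G beta]: it is the derivative at
    [G beta = 0] of the squared-error part of [L1_loss] as a function of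
    [G beta], and [d_core] below is the second derivative. *)
Definition g_core (beta : mindex J) : R :=
  - 2 * \sum_(alpha in Omega)
     (X alpha - \sum_(gamma : mindex J | gamma != beta)
                   G gamma * factor_prod alpha gamma) * factor_prod alpha beta.

Definition d_core (beta : mindex J) : R :=
  2 * \sum_(alpha in Omega) factor_prod alpha beta ^+ 2.

End SparseTucker.

(* Main.v *)
(** As a function of x = G_beta the loss is
    c + g_c x + (d_c / 2) x^2 + lambda |x|. If m is the soft-thresholded value
    and s = d_c m + g_c, then - s is a subgradient of lambda |x| at m, so the
    loss at y exceeds the loss at m by at least (d_c / 2) (y - m)^2, which
    gives uniqueness when d_c > 0. If d_c = 0, all p_(alpha, beta) with alpha
    in Omega vanish, hence g_c = 0 and the loss is c + lambda |x|. *)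
Require Import Defs.
From HB Require Import structures.
From mathcomp Require Import all_boot all_order all_algebra.
From mathcomp Require Import boolp classical_sets reals.
From mathcomp Require Import ring lra.

Set Implicit Arguments.
Unset Strict Implicit.
Unset Printing Implicit Defensive.

Import Order.TTheory GRing.Theory Num.Theory.
Local Open Scope ring_scope.

(** With [d = 0] and [|g| > lambda] the function would be unbounded below. The hypothesis
    [d = 0 -> g = 0] excludes this, so both quotients are only reached with [d > 0]. *)
Lemma argmin_quadratic_l1 (R : realType) (c g d lambda : R) :
  0 < lambda -> 0 <= d -> (d = 0 -> g = 0) ->
  argmin (fun x : R => c + g * x + d / 2 * x ^+ 2 + lambda * `|x|)
  = [set (if g > lambda then (lambda - g) / d
          else if g < - lambda then - (lambda + g) / d
          else 0)]%classic.
Proof.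
move=> lambda_gt0 d_ge0 g0; set m := (if _ then _ else _).
(* The slope [d * m + g] is [lambda], [- lambda] or [g] in the three branches. The left term then
   combines with the norms into [lambda * (|y| + y)], [lambda * (|y| - y)] or
   [g * y + lambda * |y|], the last being nonnegative because [|g| <= lambda]. *)
have subgrad y : 0 <= (d * m + g) * (y - m) + lambda * (`|y| - `|m|).
  have y_le := ler_norm y; have Ny_le : - y <= `|y| by rewrite -normrN ler_norm.
  have d_gt0 : g != 0 -> 0 < d.
    by move=> gN0; rewrite lt0r d_ge0 andbT; apply: contra_neq gN0.
  rewrite /m; case: ifPn => [g_gt|]; last rewrite -leNgt => g_le.
    have {}d_gt0 : 0 < d by apply: d_gt0; rewrite gt_eqF //; lra.
    rewrite [d * _]mulrC divfK ?gt_eqF // subrK.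
    rewrite (@ler0_norm _ (_ / d)); last first.
      by rewrite pmulr_lle0 ?invr_gt0 // subr_le0 ltW.
    by rewrite -mulrDr mulr_ge0 ?(ltW lambda_gt0) //; lra.
  case: ifPn => [g_lt|]; last rewrite -leNgt => g_ge.
    have {}d_gt0 : 0 < d by apply: d_gt0; rewrite lt_eqF //; lra.
    rewrite [d * _]mulrC divfK ?gt_eqF // opprD subrK.
    rewrite (@ger0_norm _ (_ / d)); last first.
      by rewrite pmulr_lge0 ?invr_gt0 //; lra.
    by rewrite mulNr -mulrN -mulrDr mulr_ge0 ?(ltW lambda_gt0) //; lra.
  rewrite normr0 mulr0 add0r !subr0.
  by case: (lerP 0 y) => y0; nra.
(* Completing the square at [m]: the right side minus the left is exactly the expression bounded in
   [subgrad]. *)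
have gap y : d / 2 * (y - m) ^+ 2 <=
    (c + g * y + d / 2 * y ^+ 2 + lambda * `|y|)
    - (c + g * m + d / 2 * m ^+ 2 + lambda * `|m|).
  rewrite -subr_ge0; apply: le_trans (subgrad y) _.
  by rewrite le_eqVlt; apply/orP; left; apply/eqP; field.
apply/seteqP; split => [y /(_ m) y_min | _ -> y] /=; last first.
  rewrite -subr_ge0; apply: le_trans (gap y).
  by rewrite mulr_ge0 ?divr_ge0 ?sqr_ge0.
(* For [d = 0] the quadratic gap vanishes, and uniqueness comes from [lambda * |y| <= 0] instead. *)
have [d0|dN0] := eqVneq d 0.
  have m0 : m = 0.
    by rewrite /m g0 // oppr_gt0 ltNge ltW.
  move: y_min; rewrite m0 d0 g0 // normr0 !mul0r !mulr0 !addr0 gerDl.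
  by rewrite pmulr_rle0 // normr_le0 => /eqP.
have d2_gt0 : 0 < d / 2 by rewrite divr_gt0 // lt0r dN0.
have : d / 2 * (y - m) ^+ 2 <= 0 by apply: le_trans (gap y) _; rewrite subr_le0.
rewrite pmulr_rle0 // => sq_le0.
by apply/eqP; rewrite -subr_eq0 -sqrf_eq0 eq_le sq_le0 sqr_ge0.
Qed.

Section CoreEntry.
Variables (R : realType) (N : nat) (I J : 'I_N -> nat).
Variables (X : tensor R I) (Omega : {set mindex I}) (lambda : R).
Variables (G : tensor R J) (A : forall n : 'I_N, 'M[R]_(I n, J n)).
Variable beta : mindex J.

Lemma d_core_ge0 : 0 <= d_core Omega A beta.
Proof. by rewrite mulr_ge0 ?sumr_ge0 // => alpha _; rewrite sqr_ge0. Qed.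

Lemma d_core_eq0_g_core : d_core Omega A beta = 0 -> g_core X Omega G A beta = 0.
Proof.
move/eqP; rewrite mulf_eq0 pnatr_eq0 /= psumr_eq0; last first.
  by move=> alpha _; rewrite sqr_ge0.
move/allP => p0; rewrite /g_core big1 ?mulr0 // => alpha Oalpha.
have /implyP/(_ Oalpha) := p0 alpha (mem_index_enum _).
by rewrite sqrf_eq0 => /eqP ->; rewrite mulr0.
Qed.

(** [F] takes both the index and the entry, so that one splitting serves the norm of the core tensor
    and its contraction with the factors. *)
Lemma sum_tensor_set (F : mindex J -> R -> R) (x : R) :
  \sum_gamma F gamma (tensor_set G beta x gamma)
  = F beta x + \sum_(gamma | gamma != beta) F gamma (G gamma).
Proof.
rewrite (bigD1 beta) //= ffunE eqxx; congr (_ + _).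
by apply: eq_bigr => gamma /negPf neq; rewrite ffunE neq.
Qed.

Lemma L1_loss_tensor_set (x : R) :
  L1_loss X Omega lambda (tensor_set G beta x) A =
  L1_loss X Omega lambda (tensor_set G beta 0) A + g_core X Omega G A beta * x
  + d_core Omega A beta / 2 * x ^+ 2 + lambda * `|x|.
Proof.
rewrite /L1_loss /tensor_norm1 !(sum_tensor_set (fun _ y => `|y|)).
set S := \sum_(gamma | _) `|_|; set W := \sum_(n < N) _.
(* [r alpha] is the residual at [G beta = 0]. Expanding [(r alpha - x * p) ^+ 2] yields [g_core]
   from the cross terms and half of [d_core] from the squares. *)
pose r alpha := X alpha
  - \sum_(gamma | gamma != beta) G gamma * factor_prod A alpha gamma.
have residual alpha y : X alpha - \sum_gamma
    tensor_set G beta y gamma * factor_prod A alpha gamma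
    = r alpha - y * factor_prod A alpha beta.
  rewrite (sum_tensor_set (fun gamma z => z * factor_prod A alpha gamma)).
  by rewrite /r; ring.
under eq_bigr do rewrite residual.
under [in RHS]eq_bigr do rewrite residual mul0r subr0.
have -> : \sum_(alpha in Omega) (r alpha - x * factor_prod A alpha beta) ^+ 2
    = \sum_(alpha in Omega) r alpha ^+ 2 + g_core X Omega G A beta * x
      + d_core Omega A beta / 2 * x ^+ 2.
  rewrite /g_core /d_core (mulrAC 2) divff ?pnatr_eq0 // mul1r.
  rewrite (mulrAC _ _ x) !mulr_sumr mulr_suml -!big_split /=.
  by apply: eq_bigr => alpha _; rewrite -/(r alpha); ring.
by rewrite normr0; ring.
Qed.

End CoreEntry.

Theorem lemma4 (R : realType) (N : nat) (hN : (1 <= N)%N) (I J : 'I_N -> nat)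
    (X : tensor R I) (Omega : {set mindex I})
    (lambda : R) (hlambda : 0 < lambda)
    (G : tensor R J) (A : forall n : 'I_N, 'M[R]_(I n, J n))
    (beta : mindex J) :
  let gc := g_core X Omega G A beta in
  let dc := d_core Omega A beta in
  argmin (fun x : R => L1_loss X Omega lambda (tensor_set G beta x) A)
  = [set (if gc > lambda then (lambda - gc) / dc
          else if gc < - lambda then - (lambda + gc) / dc
          else 0)]%classic.
Proof.
move=> gc dc; have -> : (fun x => L1_loss X Omega lambda (tensor_set G beta x) A)
    = (fun x => L1_loss X Omega lambda (tensor_set G beta 0) A
                + gc * x + dc / 2 * x ^+ 2 + lambda * `|x|).
  by apply: funext => x; exact: L1_loss_tensor_set.
apply: argmin_quadratic_l1 => //; first exact: d_core_ge0.
exact: d_core_eq0_g_core.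
Qed.
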